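(* Let $(\mathbf{A},\mathbf{E})$ be a regular matrix pencil, $\mathbf{A},\mathbf{E}\in\mathbb{C}^{n\times n}$, all of whose finite eigenvalues have strictly negative real part, let $\mu\in\mathbb{C}$ be such that $\mathbf{A}-\mu\mathbf{E}$ is invertible, and suppose that $\alpha_\varepsilon(\mathbf{A},\mathbf{E})>0$ for some given $\varepsilon>0$. Then for all $\tau>0$, $$\max_{t\in[0,\tau]}\big\|\mathrm{e}^{t(\mathbf{G}_\mu^{-1}+\mu\mathbf{I})}\big\|\ \ge\ \mathrm{e}^{\tau\alpha_\varepsilon(\mathbf{A},\mathbf{E})}\left(\frac{1}{1+\varepsilon\big(\mathrm{e}^{\tau\alpha_\varepsilon(\mathbf{A},\mathbf{E})}-1\big)/\alpha_\varepsilon(\mathbf{A},\mathbf{E})}\right),$$ and for each $\tau>0$ there exist some nonzero initial condition $\mathbf{x}(0)\in\mathrm{Ran}(\mathbf{Q}_\mu)$ and some $t\in[0,\tau]$ such that, for the solution $\mathbf{x}(\cdot)$ of $\mathbf{E}\mathbf{x}'(t)=\mathbf{A}\mathbf{x}(t)$, the ratio $\|\mathbf{x}(t)\|/\|\mathbf{x}(0)\|$ attains this growth, i.e., is at least the right-hand side above.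
   Context: $\|\cdot\|$ is the Euclidean vector norm and the matrix norm it induces, with the convention $\|\mathbf{X}^{-1}\|=\infty$ when $\mathbf{X}$ is a square matrix that is not invertible. The pencil $(\mathbf{A},\mathbf{E})$ is regular if $\mathbf{A}-\mu\mathbf{E}$ is invertible for some $\mu\in\mathbb{C}$; its finite eigenvalues are the $\lambda\in\mathbb{C}$ with $\mathbf{A}-\lambda\mathbf{E}$ singular. $\mathrm{Ran}(\cdot)$ is the column space. For $\mu\in\mathbb{C}$ with $\mathbf{A}-\mu\mathbf{E}$ invertible, let $\mathbf{E}_\mu:=(\mathbf{A}-\mu\mathbf{E})^{-1}\mathbf{E}$, let $d$ be the algebraic multiplicity of $0$ as an eigenvalue of $\mathbf{E}_\mu$ (with $d<n$ understood, so that $\mathbf{G}_\mu$ below is not empty), and take a Schur factorization $$\mathbf{E}_\mu=[\mathbf{Q}_\mu\ \widetilde{\mathbf{Q}}_\mu]\begin{bmatrix}\mathbf{G}_\mu&\mathbf{D}_\mu\\ \mathbf{0}&\mathbf{N}_\mu\end{bmatrix}[\mathbf{Q}_\mu\ \widetilde{\mathbf{Q}}_\mu]^*$$ with $[\mathbf{Q}_\mu\ \widetilde{\mathbf{Q}}_\mu]$ unitary, $\mathbf{Q}_\mu\in\mathbb{C}^{n\times(n-d)}$, the middle factor upper triangular, $\mathbf{N}_\mu\in\mathbb{C}^{d\times d}$ nilpotent, and $\mathbf{G}_\mu\in\mathbb{C}^{(n-d)\times(n-d)}$ with $0\notin\sigma(\mathbf{G}_\mu)$. The initial conditions consistent with the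 differential-algebraic equation $\mathbf{E}\mathbf{x}'(t)=\mathbf{A}\mathbf{x}(t)$ are exactly those $\mathbf{x}(0)\in\mathrm{Ran}(\mathbf{Q}_\mu)$, and each such $\mathbf{x}(0)$ determines a unique solution. The $\varepsilon$-pseudospectrum of the pencil is $\sigma_\varepsilon(\mathbf{A},\mathbf{E}):=\{z\in\mathbb{C}:\|(z\mathbf{I}-(\mathbf{G}_\mu^{-1}+\mu\mathbf{I}))^{-1}\|>1/\varepsilon\}$ (independent of $\mu$), and the $\varepsilon$-pseudospectral abscissa is $\alpha_\varepsilon(\mathbf{A},\mathbf{E}):=\sup_{z\in\sigma_\varepsilon(\mathbf{A},\mathbf{E})}\mathrm{Re}\,z$. *)

(* Defs.v *)
From HB Require Import structures.
From mathcomp Require Import all_boot all_order all_algebra.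
From mathcomp Require Import all_classical all_reals all_analysis.
From mathcomp Require Import complex.

Set Implicit Arguments.
Unset Strict Implicit.
Unset Printing Implicit Defensive.

Import Order.TTheory GRing.Theory Num.Theory.
Import numFieldNormedType.Exports.

Local Open Scope classical_set_scope.
Local Open Scope ring_scope.
Local Open Scope complex_scope.
Local Open Scope sesquilinear_scope.

(* MathComp-Analysis puts the topology of the modulus on K^o for an abstract
   numFieldType K, but not on the concrete type R[i]; this instance transports
   it, so that 'M[R[i]]_(m, n) is a normed module and limits make sense there. *)
Set Warnings "-redundant-canonical-projection".
HB.instance Definition _ (R : realType) := NormedModule.copy R[i] R[i]^o.
Set Warnings "redundant-canonical-projection".

(* The norms below are R-valued; the library norm `|_| on matrices is the
   (R[i]-valued) maximum norm. *)
Definition enorm (R : realType) (n : nat) (v : 'cV[R[i]]_n) : R :=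
  Num.sqrt (\sum_(i < n) (complex.Re `|v i ord0|) ^+ 2).

(* The unit ball rather than the unit sphere, so that the set is also nonempty
   in dimension 0. *)
Definition opnorm (R : realType) (m n : nat) (M : 'M[R[i]]_(m, n)) : R :=
  sup [set enorm (M *m v) | v in [set v : 'cV[R[i]]_n | enorm v <= 1]].

Definition invnorm (R : realType) (n : nat) (X : 'M[R[i]]_n) : \bar R :=
  if X \in unitmx then (opnorm (invmx X))%:E else +oo%E.

Definition expmx (R : realType) (n : nat) (M : 'M[R[i]]_n) : 'M[R[i]]_n :=
  limn (series (fun k : nat => (k`!%:R : R[i])^-1 *: M ^+ k)).

Definition regular_pencil (R : realType) (n : nat) (A E : 'M[R[i]]_n) : Prop :=
  exists mu : R[i], A - mu *: E \in unitmx.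

Definition finite_eigenvalue (R : realType) (n : nat) (A E : 'M[R[i]]_n)
    (lambda : R[i]) : Prop :=
  A - lambda *: E \notin unitmx.

Definition shift_inv (R : realType) (n : nat) (A E : 'M[R[i]]_n) (mu : R[i]) :
    'M[R[i]]_n :=
  invmx (A - mu *: E) *m E.

(* [row_mx Q Qt] has n rows and (n - d) + d columns; these numbers are equal
   because d <= n, but not convertible.  [unitarymx] requires X X^* = 1, which
   for such a matrix also gives X^* X = 1.  Upper triangularity is that of the
   transpose, as [is_trig_mx] means lower triangular. *)
Record schur_factorization (R : realType) (n d : nat)
    (A E : 'M[R[i]]_n) (mu : R[i])
    (Q : 'M[R[i]]_(n, n - d)) (Qt : 'M[R[i]]_(n, d))
    (G : 'M[R[i]]_(n - d)) (D : 'M[R[i]]_(n - d, d)) (N : 'M[R[i]]_d) : Prop :=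
  SchurFactorization {
    schur_mult : d = mup 0 (char_poly (shift_inv A E mu));
    schur_unitary : row_mx Q Qt \is unitarymx;
    schur_eq : shift_inv A E mu =
      row_mx Q Qt *m block_mx G D 0 N *m (row_mx Q Qt) ^t*;
    schur_upper : is_trig_mx (block_mx G D 0 N)^T;
    schur_nilpotent : exists k : nat, N ^+ k = 0;
    schur_spectrum : ~~ eigenvalue G 0
  }.

(* The matrix G^-1 + mu I, to which the pencil reduces on Ran Q. *)
Definition pencil_generator (R : realType) (m : nat) (G : 'M[R[i]]_m)
    (mu : R[i]) : 'M[R[i]]_m :=
  invmx G + mu%:M.

Definition pseudospectrum (R : realType) (m : nat) (G : 'M[R[i]]_m) (mu : R[i])
    (eps : R) : set R[i] :=
  [set z | ((1 / eps)%:E < invnorm (z%:M - pencil_generator G mu))%E].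

(* This set of real parts is always bounded above. *)
Definition pseudospectral_abscissa (R : realType) (m : nat) (G : 'M[R[i]]_m)
    (mu : R[i]) (eps : R) : R :=
  sup [set complex.Re z | z in pseudospectrum G mu eps].

(* x'(t) = v relative to [0, +oo[, hence one-sided at t = 0. *)
Definition has_derivative_at (R : realType) (n : nat) (x : R -> 'cV[R[i]]_n)
    (t : R) (v : 'cV[R[i]]_n) : Prop :=
  ((s - t)^-1)%:C *: (x s - x t) @[s --> within `[0, +oo[ t^'] --> v.

Definition dae_solution (R : realType) (n : nat) (A E : 'M[R[i]]_n)
    (x0 : 'cV[R[i]]_n) (x : R -> 'cV[R[i]]_n) : Prop :=
  x 0 = x0 /\
  forall t : R, 0 <= t ->
    exists2 v : 'cV[R[i]]_n, has_derivative_at x t v & E *m v = A *m x t.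

(* x is the solution: any other one agrees with it on [0, +oo[. *)
Definition unique_dae_solution (R : realType) (n : nat) (A E : 'M[R[i]]_n)
    (x0 : 'cV[R[i]]_n) (x : R -> 'cV[R[i]]_n) : Prop :=
  dae_solution A E x0 x /\
  forall y : R -> 'cV[R[i]]_n, dae_solution A E x0 y ->
    forall t : R, 0 <= t -> y t = x t.

Definition growth_bound (R : realType) (eps alpha tau : R) : R :=
  expR (tau * alpha) * (1 / (1 + eps * (expR (tau * alpha) - 1) / alpha)).

(* Main.v *)
(* Let [B = G^-1 + mu I]. If [B u] is within [eps |u|] of [z u], then the derivative of
   [w t := e^(-zt) e^(tB) u] is [e^(-zt) e^(tB) (B u - z u)], hence bounded by
   [M eps |u| e^(-t Re z)] on [0, tau], where [M] is the maximum of [|e^(tB)|].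
   Integrating, [|u| <= |w tau| + |w tau - w 0|] gives the growth bound with
   [Re z] in place of the abscissa, and continuity lets [Re z] tend to it.
   An abscissa that is positive is a genuine supremum, since [sup] is 0 on an
   empty or unbounded set.

   A vector maximising [|e^(tB) y|] in the unit ball gives the initial
   condition [Q y], because [Q] is an isometry and the solution is
   [Q e^(tB) y]. *)
Require Import Defs.
From mathcomp Require Import all_boot all_order all_algebra.
From mathcomp Require Import all_classical all_reals all_analysis.
From mathcomp Require Import complex.
From mathcomp Require Import ring lra.

Set Implicit Arguments.
Unset Strict Implicit.
Unset Printing Implicit Defensive.

Import Order.TTheory GRing.Theory Num.Theory.
Import numFieldNormedType.Exports.

Local Open Scope classical_set_scope.
Local Open Scope ring_scope.
Local Open Scope complex_scope.
Local Open Scope sesquilinear_scope.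

(** The notion of solution shapes the part about the differential-algebraic equation: a derivative
    at 0 is one-sided, and a solution is only known to be differentiable once. Identities along an
    arbitrary solution are therefore obtained at positive times, where derivatives are two-sided,
    and reach 0 through right continuity or the initial condition; the nilpotent block is eliminated
    without any second derivative. The mean value theorem fails for complex values, so derivatives
    are kept as pairs of real ones and the vector estimate is read along one fixed direction. The
    shape of the bound: with [a = Re z] and [q = e^(-tau a)], the estimate of [|u|] becomes
    [1 <= M (q + eps (1 - q) / a)], and the reciprocal of the bracket is
    [growth_bound eps a tau]. *)

Local Notation Re := complex.Re.
Local Notation Im := complex.Im.

(** * Complex numbers by real and imaginary parts, matrices by entries *)

Lemma complex_ext (R : realType) (x y : R[i]) :
  Re x = Re y -> Im x = Im y -> x = y.
Proof. by case: x => a b; case: y => c d /= -> ->. Qed.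

Lemma ReD (R : realType) (x y : R[i]) : Re (x + y) = Re x + Re y.
Proof. by case: x; case: y. Qed.

Lemma ImD (R : realType) (x y : R[i]) : Im (x + y) = Im x + Im y.
Proof. by case: x; case: y. Qed.

Lemma ReN (R : realType) (x : R[i]) : Re (- x) = - Re x.
Proof. by case: x. Qed.

Lemma ImN (R : realType) (x : R[i]) : Im (- x) = - Im x.
Proof. by case: x. Qed.

Lemma ReM (R : realType) (x y : R[i]) : Re (x * y) = Re x * Re y - Im x * Im y.
Proof. by case: x; case: y. Qed.

Lemma ImM (R : realType) (x y : R[i]) : Im (x * y) = Re x * Im y + Im x * Re y.
Proof. by case: x; case: y. Qed.

Lemma Re_sum (R : realType) (I : Type) (r : seq I) (P : pred I) (F : I -> R[i]) :
  Re (\sum_(i <- r | P i) F i) = \sum_(i <- r | P i) Re (F i).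
Proof. by apply: (big_morph _ (@ReD R)). Qed.

Lemma Im_sum (R : realType) (I : Type) (r : seq I) (P : pred I) (F : I -> R[i]) :
  Im (\sum_(i <- r | P i) F i) = \sum_(i <- r | P i) Im (F i).
Proof. by apply: (big_morph _ (@ImD R)). Qed.

Lemma Re_norm_sqr (R : realType) (z : R[i]) :
  Re `|z| ^+ 2 = Re z ^+ 2 + Im z ^+ 2.
Proof. by rewrite normc_def /= sqr_sqrtr// addr_ge0// sqr_ge0. Qed.

(** The order on [R[i]] only compares numbers with equal imaginary parts, so the radii that occur in
    its metric are real. *)
Lemma complex_pos_real (R : realType) (e : R[i]) :
  0 < e -> 0 < Re e /\ e = (Re e)%:C.
Proof.
case: e => a b; rewrite ltcE /= => /andP[/eqP -> a0]; split => //.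
Qed.

Lemma normr_Re_le (R : realType) (z : R[i]) : `|Re z|%:C <= `|z|.
Proof. by rewrite normc_ge_Re. Qed.

Lemma normr_Im_le (R : realType) (z : R[i]) : `|Im z|%:C <= `|z|.
Proof.
rewrite normc_def lecR -[leLHS]sqrtr_sqr ler_wsqrtr//.
by rewrite lerDr sqr_ge0.
Qed.

Lemma normr_le_ReIm (R : realType) (z : R[i]) : `|z| <= (`|Re z| + `|Im z|)%:C.
Proof.
rewrite normc_def lecR -[leRHS]ger0_norm ?addr_ge0//.
rewrite -[leRHS]sqrtr_sqr ler_wsqrtr//.
rewrite sqrrD !real_normK ?num_real// -addrA lerD2l lerDr.
by rewrite mulrn_wge0// mulr_ge0.
Qed.

Lemma cvg_complexP (R : realType) (T : Type) (F : set_system T) (f : T -> R[i])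
    (l : R[i]) : Filter F ->
  f x @[x --> F] --> l <->
  Re (f x) @[x --> F] --> Re l /\ Im (f x) @[x --> F] --> Im l.
Proof.
move=> FF; split.
  move=> /cvgrPdist_lt H; split; apply/cvgrPdist_lt => e e0.
    have e0' : 0 < e%:C by rewrite ltcR.
    apply: filterS (H _ e0') => x.
    by rewrite -ReN -ReD -ltcR; apply: le_lt_trans; exact: normr_Re_le.
  have e0' : 0 < e%:C by rewrite ltcR.
  apply: filterS (H _ e0') => x.
  by rewrite -ImN -ImD -ltcR; apply: le_lt_trans; exact: normr_Im_le.
case=> /cvgrPdist_lt H1 /cvgrPdist_lt H2; apply/cvgrPdist_lt => e.
move=> /complex_pos_real[e0 ->]; have e20 : 0 < Re e / 2 by rewrite divr_gt0.
apply: filterS2 (H1 _ e20) (H2 _ e20) => x.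
rewrite -ReN -ReD -ImN -ImD => h1 h2.
apply: le_lt_trans; first exact: normr_le_ReIm.
by rewrite ltcR (splitr (Re e)) ltrD.
Qed.

Lemma cvg_mxP (T : topologicalType) (S : Type) (m n : nat) (F : set_system S)
    (f : S -> 'M[T]_(m, n)) (l : 'M[T]_(m, n)) : Filter F ->
  f x @[x --> F] --> l <-> forall i j, f x i j @[x --> F] --> l i j.
Proof.
move=> FF; split=> [H i j A Aij|H A [P Pn PA]].
  apply: (H [set M : 'M[T]_(m, n) | A (M i j)]).
  (* The box constrains the entry [(i, j)] and leaves all others free. *)
  exists (fun i' j' => [set x | (i' == i) && (j' == j) -> A x]) => [i' j'|M /=].
    have [/andP[/eqP -> /eqP ->]|ne] := boolP ((i' == i) && (j' == j)).
      by apply: filterS Aij => x Ax _.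
    by apply: nearW.
  by move=> /(_ i j); rewrite !eqxx; apply.
suff : \forall x \near F, forall i j, P i j (f x i j).
  by apply: filterS => x Px; apply: PA => i j; exact: Px.
by apply: filter_forall => i; apply: filter_forall => j; exact: (H i j _ (Pn i j)).
Qed.

(** * Derivatives of complex and matrix valued functions of a real variable *)

(** Real and imaginary parts are differentiated separately so that the mean value theorem and the
    differentiation of real power series apply to each. *)
Definition is_cderive (R : realType) (t : R) (f : R -> R[i]) (v : R[i]) : Prop :=
  is_derive t (1 : R) (fun s => Re (f s)) (Re v) /\
  is_derive t (1 : R) (fun s => Im (f s)) (Im v).

Definition is_mxderive (R : realType) (m n : nat) (t : R)
    (f : R -> 'M[R[i]]_(m, n)) (v : 'M[R[i]]_(m, n)) : Prop :=
  forall i j, is_cderive t (fun s => f s i j) (v i j).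

Lemma is_cderive_cst (R : realType) (t : R) (c : R[i]) :
  is_cderive t (fun=> c) 0.
Proof. by split; exact: is_derive_cst. Qed.

Lemma is_cderiveD (R : realType) (t : R) (f g : R -> R[i]) (u v : R[i]) :
  is_cderive t f u -> is_cderive t g v -> is_cderive t (fun s => f s + g s) (u + v).
Proof.
move=> [f1 f2] [g1 g2]; split; rewrite ?ReD ?ImD.
  under eq_fun do rewrite ReD.
  exact: is_deriveD.
under eq_fun do rewrite ImD.
exact: is_deriveD.
Qed.

Lemma is_cderiveM (R : realType) (t : R) (f g : R -> R[i]) (u v : R[i]) :
  is_cderive t f u -> is_cderive t g v ->
  is_cderive t (fun s => f s * g s) (u * g t + f t * v).
Proof.
move=> [f1 f2] [g1 g2]; split.
  under eq_fun do rewrite ReM.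
  have H := is_deriveB (is_deriveM f1 g1) (is_deriveM f2 g2).
  by apply: is_derive_eq H _; rewrite ReD !ReM /GRing.scale /=; ring.
under eq_fun do rewrite ImM.
have H := is_deriveD (is_deriveM f1 g2) (is_deriveM f2 g1).
by apply: is_derive_eq H _; rewrite ImD !ImM /GRing.scale /=; ring.
Qed.

Lemma is_cderive_sum (R : realType) (t : R) (I : Type) (r : seq I)
    (f : I -> R -> R[i]) (v : I -> R[i]) :
  (forall i, is_cderive t (f i) (v i)) ->
  is_cderive t (fun s => \sum_(i <- r) f i s) (\sum_(i <- r) v i).
Proof.
move=> fv; elim: r => [|i r IH].
  by rewrite big_nil; under eq_fun do rewrite big_nil; exact: is_cderive_cst.
rewrite big_cons; under eq_fun do rewrite big_cons.
exact: is_cderiveD.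
Qed.

Lemma is_mxderive_cst (R : realType) (m n : nat) (t : R) (c : 'M[R[i]]_(m, n)) :
  is_mxderive t (fun=> c) 0.
Proof. by move=> i j; rewrite mxE; exact: is_cderive_cst. Qed.

Lemma is_mxderiveM (R : realType) (m n p : nat) (t : R)
    (f : R -> 'M[R[i]]_(m, n)) (g : R -> 'M[R[i]]_(n, p))
    (u : 'M[R[i]]_(m, n)) (v : 'M[R[i]]_(n, p)) :
  is_mxderive t f u -> is_mxderive t g v ->
  is_mxderive t (fun s => f s *m g s) (u *m g t + f t *m v).
Proof.
move=> fu gv i j; rewrite !mxE -big_split /=; under eq_fun do rewrite mxE.
by apply: is_cderive_sum => k; exact: is_cderiveM.
Qed.

Lemma is_mxderiveMl (R : realType) (m n p : nat) (t : R)
    (c : 'M[R[i]]_(m, n)) (g : R -> 'M[R[i]]_(n, p)) (v : 'M[R[i]]_(n, p)) :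
  is_mxderive t g v -> is_mxderive t (fun s => c *m g s) (c *m v).
Proof.
by move=> /(is_mxderiveM (is_mxderive_cst t c)); rewrite mul0mx add0r.
Qed.

Lemma is_mxderiveMr (R : realType) (m n p : nat) (t : R)
    (f : R -> 'M[R[i]]_(m, n)) (c : 'M[R[i]]_(n, p)) (v : 'M[R[i]]_(m, n)) :
  is_mxderive t f v -> is_mxderive t (fun s => f s *m c) (v *m c).
Proof.
by move=> /is_mxderiveM /(_ (is_mxderive_cst t c)); rewrite mulmx0 addr0.
Qed.

Lemma is_mxderiveZ (R : realType) (m n : nat) (t : R) (c : R -> R[i]) (c' : R[i])
    (f : R -> 'M[R[i]]_(m, n)) (v : 'M[R[i]]_(m, n)) :
  is_cderive t c c' -> is_mxderive t f v ->
  is_mxderive t (fun s => c s *: f s) (c' *: f t + c t *: v).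
Proof.
move=> cc fv i j; rewrite !mxE; under eq_fun do rewrite mxE.
exact: is_cderiveM.
Qed.

Lemma is_cderive_ext (R : realType) (t : R) (f g : R -> R[i]) (v : R[i]) :
  {near t, f =1 g} -> is_cderive t f v -> is_cderive t g v.
Proof.
move=> fg [f1 f2]; split.
  by apply: near_eq_is_derive f1; apply: filterS fg => s /= ->.
by apply: near_eq_is_derive f2; apply: filterS fg => s /= ->.
Qed.

Lemma is_mxderive_ext (R : realType) (m n : nat) (t : R)
    (f g : R -> 'M[R[i]]_(m, n)) (v : 'M[R[i]]_(m, n)) :
  {near t, f =1 g} -> is_mxderive t f v -> is_mxderive t g v.
Proof.
move=> fg fv i j; apply: is_cderive_ext (fv i j).
by apply: filterS fg => s /= ->.
Qed.

Lemma is_mxderive_unique (R : realType) (m n : nat) (t : R)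
    (f : R -> 'M[R[i]]_(m, n)) (u v : 'M[R[i]]_(m, n)) :
  is_mxderive t f u -> is_mxderive t f v -> u = v.
Proof.
move=> fu fv; apply/matrixP => i j.
have [f1 f2] := fu i j; have [g1 g2] := fv i j.
by apply: complex_ext; [case: f1 g1|case: f2 g2] => _ <- [_ <-].
Qed.

(** * Euclidean and operator norms *)

(** The inner product of [C^n] regarded as [R^(2n)], that is, the real part of the Hermitian
    product. *)
Definition rdot (R : realType) (n : nat) (p w : 'cV[R[i]]_n) : R :=
  \sum_(i < n) (Re (p i ord0) * Re (w i ord0) + Im (p i ord0) * Im (w i ord0)).

Lemma rdotC (R : realType) (n : nat) (p w : 'cV[R[i]]_n) : rdot p w = rdot w p.
Proof. by apply: eq_bigr => i _; rewrite mulrC [X in _ + X]mulrC. Qed.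

Lemma rdotDr (R : realType) (n : nat) (p v w : 'cV[R[i]]_n) :
  rdot p (v + w) = rdot p v + rdot p w.
Proof.
rewrite /rdot -big_split; apply: eq_bigr => i _ /=.
by rewrite mxE ReD ImD; ring.
Qed.

Lemma rdotZr (R : realType) (n : nat) (p w : 'cV[R[i]]_n) (a : R) :
  rdot p (a%:C *: w) = a * rdot p w.
Proof.
rewrite /rdot mulr_sumr; apply: eq_bigr => i _ /=.
by rewrite mxE ReM ImM /=; ring.
Qed.

Lemma rdotNr (R : realType) (n : nat) (p w : 'cV[R[i]]_n) :
  rdot p (- w) = - rdot p w.
Proof.
by rewrite -scaleN1r -(rmorphN1 (real_complex R)) rdotZr mulN1r.
Qed.

Lemma rdot_ge0 (R : realType) (n : nat) (w : 'cV[R[i]]_n) : 0 <= rdot w w.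
Proof. by apply: sumr_ge0 => i _; rewrite -!expr2 addr_ge0 ?sqr_ge0. Qed.

Lemma enormE (R : realType) (n : nat) (w : 'cV[R[i]]_n) :
  enorm w = Num.sqrt (rdot w w).
Proof.
by congr Num.sqrt; apply: eq_bigr => i _; rewrite Re_norm_sqr !expr2.
Qed.

Lemma enorm_sqr (R : realType) (n : nat) (w : 'cV[R[i]]_n) :
  enorm w ^+ 2 = rdot w w.
Proof. by rewrite enormE sqr_sqrtr// rdot_ge0. Qed.

Lemma enorm_ge0 (R : realType) (n : nat) (w : 'cV[R[i]]_n) : 0 <= enorm w.
Proof. exact: sqrtr_ge0. Qed.

Lemma enorm_eq0 (R : realType) (n : nat) (w : 'cV[R[i]]_n) :
  (enorm w == 0) = (w == 0).
Proof.
rewrite -sqrf_eq0 enorm_sqr; apply/eqP/eqP => [/eqP|->]; last first.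
  by apply: big1 => i _; rewrite mxE /= !mul0r addr0.
rewrite psumr_eq0 => [/allP H|i _]; last by rewrite -!expr2 addr_ge0 ?sqr_ge0.
apply/colP => i; rewrite mxE.
have := H i; rewrite mem_index_enum => /(_ isT).
rewrite -!expr2 paddr_eq0 ?sqr_ge0// !sqrf_eq0 => /andP[/eqP h1 /eqP h2].
exact: complex_ext.
Qed.

Lemma enorm0 (R : realType) (n : nat) : enorm (0 : 'cV[R[i]]_n) = 0.
Proof. by apply/eqP; rewrite enorm_eq0. Qed.

Lemma enorm_gt0 (R : realType) (n : nat) (w : 'cV[R[i]]_n) :
  (0 < enorm w) = (w != 0).
Proof. by rewrite lt_def enorm_eq0 enorm_ge0 andbT. Qed.

Lemma enormZ (R : realType) (n : nat) (z : R[i]) (w : 'cV[R[i]]_n) :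
  enorm (z *: w) = Re `|z| * enorm w.
Proof.
apply/eqP; rewrite -(@eqrXn2 _ 2%N)// ?enorm_ge0//; last first.
  by rewrite mulr_ge0 ?enorm_ge0// normc_def /= sqrtr_ge0.
rewrite exprMn !enorm_sqr Re_norm_sqr /rdot mulr_sumr; apply/eqP/eq_bigr => i _.
by rewrite mxE ReM ImM; ring.
Qed.

Lemma enormZr (R : realType) (n : nat) (a : R) (w : 'cV[R[i]]_n) :
  enorm (a%:C *: w) = `|a| * enorm w.
Proof. by rewrite enormZ normc_def /= expr0n /= addr0 sqrtr_sqr. Qed.

Lemma enormN (R : realType) (n : nat) (w : 'cV[R[i]]_n) : enorm (- w) = enorm w.
Proof. by rewrite -scaleN1r enormZ normrN1 mul1r. Qed.

(** Cauchy-Schwarz: the square of [|w|^2 p - <p, w> w] is nonnegative and equals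
    [|w|^2 (|p|^2 |w|^2 - <p, w>^2)]. *)
Lemma rdot_le (R : realType) (n : nat) (p w : 'cV[R[i]]_n) :
  rdot p w <= enorm p * enorm w.
Proof.
have [->|w0] := eqVneq w 0.
  rewrite enorm0 mulr0 /rdot big1// => i _; rewrite !mxE /= !mulr0 addr0//.
have W0 : 0 < rdot w w by rewrite -enorm_sqr exprn_gt0// enorm_gt0.
rewrite (le_trans (ler_norm _))// -(@ler_pXn2r _ 2) ?nnegrE//; last first.
  by rewrite mulr_ge0// enorm_ge0.
rewrite exprMn !enorm_sqr real_normK ?num_real// -subr_ge0 -(pmulr_rge0 _ W0).
have := rdot_ge0 ((rdot w w)%:C *: p - (rdot p w)%:C *: w).
rewrite rdotDr rdotZr -scaleNr -rmorphN rdotZr.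
rewrite ![rdot (_ + _) _]rdotC !rdotDr !rdotZr [rdot w p]rdotC.
by congr (0 <= _); ring.
Qed.

Lemma enormD (R : realType) (n : nat) (v w : 'cV[R[i]]_n) :
  enorm (v + w) <= enorm v + enorm w.
Proof.
rewrite -(@ler_pXn2r _ 2) ?nnegrE ?addr_ge0 ?enorm_ge0//.
rewrite sqrrD !enorm_sqr rdotDr ![rdot (_ + _) _]rdotC !rdotDr [rdot w v]rdotC.
have := rdot_le v w; lra.
Qed.

Lemma enorm_le_sum (R : realType) (n : nat) (w : 'cV[R[i]]_n) :
  enorm w <= \sum_(i < n) Re `|w i ord0|.
Proof.
have H0 i : 0 <= Re `|w i ord0| by rewrite normc_def /= sqrtr_ge0.
rewrite -(@ler_pXn2r _ 2) ?nnegrE ?enorm_ge0 ?sumr_ge0//.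
rewrite /enorm sqr_sqrtr; last by apply: sumr_ge0 => i _; rewrite sqr_ge0.
rewrite expr2 mulr_suml; apply: ler_sum => i _.
rewrite expr2 ler_wpM2l// (bigD1 i)//= lerDl sumr_ge0// => j _; exact: H0.
Qed.

Lemma normr_entry_le (R : realType) (n : nat) (w : 'cV[R[i]]_n) (i : 'I_n) :
  Re `|w i ord0| <= enorm w.
Proof.
have H0 j : 0 <= Re `|w j ord0| by rewrite normc_def /= sqrtr_ge0.
rewrite -(@ler_pXn2r _ 2) ?nnegrE ?enorm_ge0//.
rewrite /enorm sqr_sqrtr; last by apply: sumr_ge0 => j _; rewrite sqr_ge0.
by rewrite (bigD1 i)//= lerDl sumr_ge0// => j _; rewrite sqr_ge0.
Qed.

(** A crude majorant of the operator norm: it makes the supremum in [opnorm] finite, controls the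
    entries of the powers of a matrix, and tends to 0 as soon as all entries do. *)
Definition mxsumnorm (R : realType) (m n : nat) (M : 'M[R[i]]_(m, n)) : R :=
  \sum_(i < m) \sum_(j < n) Re `|M i j|.

Lemma Re_norm_ge0 (R : realType) (z : R[i]) : 0 <= Re `|z|.
Proof. by rewrite normc_def /= sqrtr_ge0. Qed.

Lemma Re_normM (R : realType) (x y : R[i]) : Re `|x * y| = Re `|x| * Re `|y|.
Proof. by rewrite normrM ReM !normc_def /= mul0r subr0. Qed.

Lemma Re_norm_sum (R : realType) (n : nat) (F : 'I_n -> R[i]) :
  Re `|\sum_(i < n) F i| <= \sum_(i < n) Re `|F i|.
Proof.
by have := ler_norm_sum (index_enum 'I_n) F xpredT; rewrite -Re_sum lecE => /andP[].
Qed.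

Lemma mxsumnorm_ge0 (R : realType) (m n : nat) (M : 'M[R[i]]_(m, n)) :
  0 <= mxsumnorm M.
Proof. by do 2![apply: sumr_ge0 => ? _]; exact: Re_norm_ge0. Qed.

Lemma enorm_mulmx_le_mxsumnorm (R : realType) (m n : nat)
    (M : 'M[R[i]]_(m, n)) (v : 'cV[R[i]]_n) :
  enorm (M *m v) <= mxsumnorm M * enorm v.
Proof.
rewrite (le_trans (enorm_le_sum _))// mulr_suml ler_sum// => i _.
rewrite mxE (le_trans (Re_norm_sum _))// mulr_suml ler_sum// => j _.
by rewrite Re_normM ler_wpM2l ?Re_norm_ge0// normr_entry_le.
Qed.

Lemma opnorm_has_sup (R : realType) (m n : nat) (M : 'M[R[i]]_(m, n)) :
  has_sup [set enorm (M *m v) | v in [set v : 'cV[R[i]]_n | enorm v <= 1]].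
Proof.
split; first by exists (enorm (M *m 0)), 0 => //=; rewrite enorm0.
exists (mxsumnorm M) => _ [v /= v1 <-].
rewrite (le_trans (enorm_mulmx_le_mxsumnorm _ _))//.
by rewrite -[leRHS]mulr1 ler_wpM2l// mxsumnorm_ge0.
Qed.

Lemma enorm_mulmx_le (R : realType) (m n : nat) (M : 'M[R[i]]_(m, n))
    (v : 'cV[R[i]]_n) :
  enorm (M *m v) <= opnorm M * enorm v.
Proof.
have [->|v0] := eqVneq v 0; first by rewrite mulmx0 !enorm0 mulr0.
have vp : 0 < enorm v by rewrite enorm_gt0.
rewrite -ler_pdivrMr//.
have -> : enorm (M *m v) / enorm v = enorm (M *m ((enorm v)^-1%:C *: v)).
  by rewrite -scalemxAr enormZr ger0_norm ?invr_ge0 ?enorm_ge0// mulrC.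
apply: sup_upper_bound; first exact: opnorm_has_sup.
exists ((enorm v)^-1%:C *: v) => //=.
by rewrite enormZr ger0_norm ?invr_ge0 ?enorm_ge0// mulVf// gt_eqF.
Qed.

Lemma opnorm_le (R : realType) (m n : nat) (M : 'M[R[i]]_(m, n)) (c : R) :
  (forall v, enorm v <= 1 -> enorm (M *m v) <= c) -> opnorm M <= c.
Proof.
move=> H; apply: ge_sup => [|_ [v v1 <-]]; last exact: H.
by case: (opnorm_has_sup M).
Qed.

Lemma opnorm_ge0 (R : realType) (m n : nat) (M : 'M[R[i]]_(m, n)) :
  0 <= opnorm M.
Proof.
apply: le_trans (enorm_ge0 (M *m 0)) _.
apply: sup_upper_bound; first exact: opnorm_has_sup.
by exists 0 => //=; rewrite enorm0.
Qed.

(** This turns entrywise continuity of the exponential into continuity of its operator norm. *)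
Lemma opnorm_dist (R : realType) (m n : nat) (M N : 'M[R[i]]_(m, n)) :
  `|opnorm M - opnorm N| <= mxsumnorm (M - N).
Proof.
have key (X Y : 'M[R[i]]_(m, n)) : opnorm X <= opnorm Y + mxsumnorm (X - Y).
  apply: opnorm_le => v v1; rewrite -[X in X *m v](subrK Y) addrC mulmxDl.
  rewrite (le_trans (enormD _ _))// lerD//.
    rewrite (le_trans (enorm_mulmx_le _ _))//.
    by rewrite -[leRHS]mulr1 ler_wpM2l// opnorm_ge0.
  rewrite (le_trans (enorm_mulmx_le_mxsumnorm _ _))//.
  by rewrite -[leRHS]mulr1 ler_wpM2l// mxsumnorm_ge0.
have sym : mxsumnorm (N - M) = mxsumnorm (M - N).
  by do 2![apply: eq_bigr => ? _]; rewrite !mxE distrC.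
by rewrite ler_distlC; have := key M N; have := key N M; rewrite sym; lra.
Qed.

Lemma continuous_sum (R : realType) (T : topologicalType) (I : Type)
    (r : seq I) (F : I -> T -> R) :
  (forall i, continuous (F i)) -> continuous (fun x => \sum_(i <- r) F i x).
Proof.
move=> cF x; rewrite /continuous_at; elim: r => [|i r IH].
  by rewrite big_nil; under eq_fun do rewrite big_nil; exact: cvg_cst.
rewrite big_cons; under eq_fun do rewrite big_cons.
by apply: cvgD => //; exact: cF.
Qed.

(* A complex vector is encoded by the row of its real parts followed by the
   row of its imaginary parts, where closed bounded sets are compact. *)
Lemma opnorm_attained (R : realType) (m n : nat) (M : 'M[R[i]]_(m, n)) :
  exists2 v : 'cV[R[i]]_n, enorm v <= 1 & enorm (M *m v) = opnorm M.
Proof.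
pose toC (r : 'rV[R]_(n + n)) : 'cV[R[i]]_n :=
  \col_i Complex (r ord0 (lshift n i)) (r ord0 (rshift n i)).
have cRe (k : 'I_(n + n)) : continuous (fun r : 'rV[R]_(n + n) => r ord0 k).
  exact: coord_continuous.
(* [X = M] gives the function to maximise, and the identity matrix gives the closedness of [K]. *)
have cnorm (p : nat) (X : 'M[R[i]]_(p, n)) :
    continuous (fun r => enorm (X *m toC r)).
  move=> r; under eq_fun do rewrite enormE.
  apply: continuous_comp; last exact: sqrt_continuous.
  apply: continuous_sum => i; rewrite /= => {}r.
  have c1 : continuous (fun r => Re ((X *m toC r) i ord0)).
    rewrite (_ : (fun _ => _) = (fun r : 'rV[R]_(n + n) => \sum_(j < n)
      (Re (X i j) * r ord0 (lshift n j) - Im (X i j) * r ord0 (rshift n j)))).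
      apply: continuous_sum => j s; have Fs := nbhs_filter s.
      by apply: cvgB; (apply: cvgM; [exact: cvg_cst|exact: cRe]).
    apply/funext => s; rewrite mxE Re_sum; apply: eq_bigr => j _.
    by rewrite ReM !mxE.
  have c2 : continuous (fun r => Im ((X *m toC r) i ord0)).
    rewrite (_ : (fun _ => _) = (fun r : 'rV[R]_(n + n) => \sum_(j < n)
      (Re (X i j) * r ord0 (rshift n j) + Im (X i j) * r ord0 (lshift n j)))).
      apply: continuous_sum => j s; have Fs := nbhs_filter s.
      by apply: cvgD; (apply: cvgM; [exact: cvg_cst|exact: cRe]).
    apply/funext => s; rewrite mxE Im_sum; apply: eq_bigr => j _.
    by rewrite ImM !mxE.
  have Fs := nbhs_filter r.
  by apply: cvgD; apply: cvgM; by [exact: c1|exact: c2].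
pose K := [set r : 'rV[R]_(n + n) | enorm (toC r) <= 1].
have toC0 : toC 0 = 0 by apply/colP => i; rewrite !mxE.
have K0 : K !=set0 by exists 0; rewrite /K /= toC0 enorm0.
have Kcl : closed K.
  have -> : K = (fun r => enorm (1%:M *m toC r)) @^-1` [set x | x <= 1].
    by apply/seteqP; split=> r /=; rewrite /K /= mul1mx.
  apply: closed_comp; last exact: closed_le.
  by move=> r _; exact: cnorm.
have Kbd : bounded_set K.
  exists 1; split; first exact: num_real.
  move=> x x1 r /= Kr; rewrite /Num.Def.normr /= mx_normrE.
  apply: bigmax_le => [|[i j] _ /=]; first by rewrite (le_trans ler01)// ltW.
  (* Each real coordinate is bounded by the modulus of a complex entry, hence by the Euclidean
     norm. *)
  rewrite (le_trans _ (ltW x1))// (le_trans _ Kr)// (ord1 i).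
  case: (split_ordP j) => k ->.
    rewrite (le_trans _ (normr_entry_le (toC r) k))//.
    by have := normr_Re_le (toC r k ord0); rewrite lecE => /andP[_ /=]; rewrite !mxE.
  rewrite (le_trans _ (normr_entry_le (toC r) k))//.
  by have := normr_Im_le (toC r k ord0); rewrite lecE => /andP[_ /=]; rewrite !mxE.
have [|r] := @compact_EVT_max _ R (fun r => enorm (M *m toC r)) K K0
  (bounded_closed_compact Kbd Kcl).
  by apply: continuous_subspaceT; exact: cnorm.
rewrite inE => Kr max; exists (toC r) => //; apply/eqP; rewrite eq_le.
apply/andP; split.
  by apply: sup_upper_bound; [exact: opnorm_has_sup|exists (toC r)].
apply: opnorm_le => v v1.
pose s := row_mx (\row_i Re (v i ord0)) (\row_i Im (v i ord0)).
have sv : toC s = v.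
  by apply/colP => i; rewrite mxE row_mxEl row_mxEr !mxE; exact: complex_ext.
by rewrite -sv max// inE /K /= sv.
Qed.

Lemma rdotE (R : realType) (n : nat) (p w : 'cV[R[i]]_n) :
  rdot p w = Re ((p ^t* *m w) ord0 ord0).
Proof.
rewrite mxE Re_sum; apply: eq_bigr => i _; rewrite !mxE.
have -> : (p i ord0)^*%R = (p i ord0)^*%C by [].
by case: (p i ord0) => a b; case: (w i ord0) => c d /=; ring.
Qed.

Lemma enorm_isometry (R : realType) (m n : nat) (Q : 'M[R[i]]_(m, n))
    (y : 'cV[R[i]]_n) :
  Q ^t* *m Q = 1%:M -> enorm (Q *m y) = enorm y.
Proof.
move=> QQ; rewrite !enormE !rdotE trmx_mul map_mxM -mulmxA (mulmxA _ Q) QQ.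
by rewrite mul1mx.
Qed.

(** * The matrix exponential *)

(** Comparison with [D e^(c |x|)]. A bound of the form [D c^k / k!] passes to the derived series
    with [D c] in place of [D], so the same test covers the series and its successive derived
    series. *)
Lemma cvgn_exp_dominated (R : realType) (a : nat -> R) (D c x : R) :
  0 <= c -> (forall k, `|a k| <= D * c ^+ k / k`!%:R) -> cvgn (pseries a x).
Proof.
move=> c0 aD; apply: normed_cvg.
have D0 : 0 <= D by have := le_trans (normr_ge0 _) (aD 0%N); rewrite fact0 mulr1 divr1.
apply: (@series_le_cvg _ _ (fun k => D * exp_coeff (c * `|x|) k)) => [k|k|k|].
- exact: normr_ge0.
- by rewrite mulr_ge0// exp_coeff_ge0// mulr_ge0.
- rewrite /= normrM normrX /exp_coeff /= exprMn.
  rewrite (le_trans (ler_wpM2r _ (aD k))) ?exprn_ge0//.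
  by rewrite le_eqVlt; apply/orP; left; apply/eqP; ring.
- rewrite (_ : series _ = (fun n => D * series (exp_coeff (c * `|x|)) n)).
    by apply: is_cvgMr; exact: is_cvg_series_exp_coeff.
  by apply/funext => n; rewrite /series /= mulr_sumr.
Qed.

Lemma exp_dominated_diffs (R : realType) (a : nat -> R) (D c : R) :
  (forall k, `|a k| <= D * c ^+ k / k`!%:R) ->
  forall k, `|pseries_diffs a k| <= D * c * c ^+ k / k`!%:R.
Proof.
move=> aD k; rewrite /pseries_diffs normrM ger0_norm ?ler0n//.
rewrite (le_trans (ler_wpM2l _ (aD k.+1))) ?ler0n//.
rewrite factS natrM exprS le_eqVlt; apply/orP; left; apply/eqP.
have : (k.+1%:R : R) != 0 by rewrite pnatr_eq0.
have : (k`!%:R : R) != 0 by rewrite pnatr_eq0 -lt0n fact_gt0.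
by move: (k`!%:R : R) (k.+1%:R : R) => x y x0 y0; field; rewrite x0.
Qed.

Lemma is_derive_exp_dominated (R : realType) (a : nat -> R) (D c x : R) :
  0 <= c -> (forall k, `|a k| <= D * c ^+ k / k`!%:R) ->
  is_derive x (1 : R) (fun t => limn (pseries a t))
    (limn (pseries (pseries_diffs a) x)).
Proof.
move=> c0 aD; have aD1 := exp_dominated_diffs aD.
(* The series converge everywhere; [|x| + 1] is merely a point of modulus larger than [|x|]. *)
apply: (@pseries_snd_diffs _ a (`|x| + 1)).
- exact: cvgn_exp_dominated aD.
- exact: cvgn_exp_dominated aD1.
- exact: cvgn_exp_dominated (exp_dominated_diffs aD1).
- by rewrite [ltRHS]ger0_norm ?ltrDl// addr_ge0.
Qed.

Lemma expr_entry_le (R : realType) (n : nat) (M : 'M[R[i]]_n) k i j :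
  Re `|(M ^+ k) i j| <= mxsumnorm M ^+ k.
Proof.
elim: k i j => [|k IH] i j.
  rewrite expr0 mxE; case: (i == j); rewrite normc_def /=.
    by rewrite expr1n expr0n addr0 sqrtr1.
  by rewrite expr0n addr0 sqrtr0.
rewrite !exprS mxE (le_trans (Re_norm_sum _))//.
apply: (@le_trans _ _ (\sum_l Re `|M i l| * mxsumnorm M ^+ k)).
  by apply: ler_sum => l _; rewrite Re_normM ler_wpM2l// Re_norm_ge0.
rewrite -mulr_suml ler_wpM2r ?exprn_ge0 ?mxsumnorm_ge0//.
rewrite /mxsumnorm [leRHS](bigD1 i)//= lerDl.
by do 2![apply: sumr_ge0 => ? _]; exact: Re_norm_ge0.
Qed.

(** For fixed [M], an entry of [expmx (t M)] is a pair of real power series in [t]; these are the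
    coefficients of its real part. *)
Definition expmx_Re (R : realType) (n : nat) (M : 'M[R[i]]_n) (i j : 'I_n)
  (k : nat) : R := Re ((M ^+ k) i j) / k`!%:R.

Definition expmx_Im (R : realType) (n : nat) (M : 'M[R[i]]_n) (i j : 'I_n)
  (k : nat) : R := Im ((M ^+ k) i j) / k`!%:R.

Lemma expmx_Re_dominated (R : realType) (n : nat) (M : 'M[R[i]]_n) i j k :
  `|expmx_Re M i j k| <= 1 * mxsumnorm M ^+ k / k`!%:R.
Proof.
rewrite mul1r /expmx_Re normrM [X in _ * X]ger0_norm ?invr_ge0 ?ler0n//.
rewrite ler_wpM2r ?invr_ge0 ?ler0n// (le_trans _ (expr_entry_le M k i j))//.
by have := normr_Re_le ((M ^+ k) i j); rewrite lecE => /andP[].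
Qed.

Lemma expmx_Im_dominated (R : realType) (n : nat) (M : 'M[R[i]]_n) i j k :
  `|expmx_Im M i j k| <= 1 * mxsumnorm M ^+ k / k`!%:R.
Proof.
rewrite mul1r /expmx_Im normrM [X in _ * X]ger0_norm ?invr_ge0 ?ler0n//.
rewrite ler_wpM2r ?invr_ge0 ?ler0n// (le_trans _ (expr_entry_le M k i j))//.
by have := normr_Im_le ((M ^+ k) i j); rewrite lecE => /andP[].
Qed.

Lemma exprZmx (R : realType) (n : nat) (z : R[i]) (M : 'M[R[i]]_n) k :
  (z *: M) ^+ k = z ^+ k *: M ^+ k.
Proof.
elim: k => [|k IH]; first by rewrite !expr0 scale1r.
by rewrite !exprS IH -!mulmxE -scalemxAl -scalemxAr scalerA.
Qed.

Definition expmx_term (R : realType) (n : nat) (M : 'M[R[i]]_n) (t : R) (k : nat)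
    : 'M[R[i]]_n := (k`!%:R : R[i])^-1 *: (t%:C *: M) ^+ k.

Lemma expmx_term_entry (R : realType) (n : nat) (M : 'M[R[i]]_n) t k i j :
  (expmx_term M t k) i j = (t ^+ k / k`!%:R)%:C * (M ^+ k) i j.
Proof.
rewrite /expmx_term exprZmx !mxE mulrA; congr (_ * _).
by rewrite rmorphM fmorphV rmorph_nat rmorphXn mulrC.
Qed.

Lemma Re_realM (R : realType) (a : R) (z : R[i]) : Re (a%:C * z) = a * Re z.
Proof. by rewrite ReM /= mul0r subr0. Qed.

Lemma Im_realM (R : realType) (a : R) (z : R[i]) : Im (a%:C * z) = a * Im z.
Proof. by rewrite ImM /= mul0r addr0. Qed.

Lemma expmx_series_cvg (R : realType) (n : nat) (M : 'M[R[i]]_n) (t : R) :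
  series (expmx_term M t) @ \oo --> \matrix_(i, j)
    Complex (limn (pseries (expmx_Re M i j) t)) (limn (pseries (expmx_Im M i j) t)).
Proof.
have c0 := mxsumnorm_ge0 M.
apply/cvg_mxP => i j; apply/cvg_complexP; rewrite !mxE /=; split.
  rewrite (_ : (fun _ => _) = pseries (expmx_Re M i j) t).
    exact: cvgn_exp_dominated (expmx_Re_dominated M i j).
  apply/funext => N; rewrite /series /= summxE Re_sum; apply: eq_bigr => k _.
  by rewrite expmx_term_entry Re_realM /expmx_Re /=; ring.
rewrite (_ : (fun _ => _) = pseries (expmx_Im M i j) t).
  exact: cvgn_exp_dominated (expmx_Im_dominated M i j).
apply/funext => N; rewrite /series /= summxE Im_sum; apply: eq_bigr => k _.
by rewrite expmx_term_entry Im_realM /expmx_Im /=; ring.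
Qed.

Lemma expmx_cvg (R : realType) (n : nat) (M : 'M[R[i]]_n) (t : R) :
  series (expmx_term M t) @ \oo --> expmx (t%:C *: M).
Proof.
have H := @expmx_series_cvg _ _ M t.
rewrite /expmx -/(expmx_term M t) (cvg_lim _ H)//; exact: norm_hausdorff.
Qed.

Lemma expmxE (R : realType) (n : nat) (M : 'M[R[i]]_n) (t : R) i j :
  expmx (t%:C *: M) i j = Complex (limn (pseries (expmx_Re M i j) t))
    (limn (pseries (expmx_Im M i j) t)).
Proof.
have H := @expmx_series_cvg _ _ M t.
rewrite /expmx -/(expmx_term M t) (cvg_lim _ H) ?mxE//; exact: norm_hausdorff.
Qed.

Lemma cvg_mulmx (R : realType) (S : Type) (F : set_system S) (m n p q : nat)
    (A : 'M[R[i]]_(m, n)) (B : 'M[R[i]]_(p, q)) (f : S -> 'M[R[i]]_(n, p)) l :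
  Filter F -> f x @[x --> F] --> l -> A *m f x *m B @[x --> F] --> A *m l *m B.
Proof.
move=> FF /cvg_mxP fl; apply/cvg_mxP => i j.
under eq_fun do rewrite mxE.
rewrite mxE; apply: cvg_big => [|k _]; first exact: add_continuous.
apply: cvgM; last exact: cvg_cst.
under eq_fun do rewrite mxE.
rewrite mxE; apply: cvg_big => [|r _]; first exact: add_continuous.
by apply: cvgM; [exact: cvg_cst|exact: fl].
Qed.

(** Termwise differentiation replaces [M^k] by [M^(k+1)] under the same factorial. The factors [A]
    and [B] let one computation yield the derivative both as [M e^(tM)] and as [e^(tM) M]. *)
Lemma is_mxderive_expmx_factor (R : realType) (n : nat) (A B M : 'M[R[i]]_n) (t : R) :
  (forall k, A *m M ^+ k *m B = M ^+ k.+1) ->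
  is_mxderive t (fun s => expmx (s%:C *: M)) (A *m expmx (t%:C *: M) *m B).
Proof.
move=> AMB i j; have c0 := mxsumnorm_ge0 M.
have H : A *m series (expmx_term M t) N *m B @[N --> \oo] -->
  A *m expmx (t%:C *: M) *m B by apply: cvg_mulmx; exact: expmx_cvg.
have entry N : (A *m series (expmx_term M t) N *m B) i j =
    \sum_(0 <= k < N) (t ^+ k / k`!%:R)%:C * (M ^+ k.+1) i j.
  rewrite /series /= mulmx_sumr mulmx_suml summxE; apply: eq_bigr => k _.
  rewrite -AMB /expmx_term exprZmx scalerA -scalemxAr -scalemxAl mxE.
  by congr (_ * _); rewrite rmorphM fmorphV rmorph_nat rmorphXn mulrC.
move/cvg_mxP : H => /(_ i j) /cvg_complexP[H1 H2].
have fk k : (k.+1%:R * (k.+1)`!%:R^-1 : R) = k`!%:R^-1.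
  by rewrite factS natrM invfM mulVKf.
split.
  under eq_fun do rewrite expmxE /=.
  apply: (is_derive_eq (is_derive_exp_dominated t c0 (expmx_Re_dominated M i j))).
  apply: cvg_lim => //; apply: cvg_trans H1; apply: near_eq_cvg; apply: nearW => N.
  rewrite entry Re_sum; apply: eq_bigr => k _.
  by rewrite Re_realM /pseries_diffs /expmx_Re /= -fk; ring.
under eq_fun do rewrite expmxE /=.
apply: (is_derive_eq (is_derive_exp_dominated t c0 (expmx_Im_dominated M i j))).
apply: cvg_lim => //; apply: cvg_trans H2; apply: near_eq_cvg; apply: nearW => N.
rewrite entry Im_sum; apply: eq_bigr => k _.
by rewrite Im_realM /pseries_diffs /expmx_Im /= -fk; ring.
Qed.

Lemma is_mxderive_expmx (R : realType) (n : nat) (M : 'M[R[i]]_n) (t : R) :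
  is_mxderive t (fun s => expmx (s%:C *: M)) (M *m expmx (t%:C *: M)).
Proof.
rewrite -[M *m _]mulmx1; apply: is_mxderive_expmx_factor => k.
by rewrite mulmx1 exprS mulmxE.
Qed.

Lemma is_mxderive_expmxr (R : realType) (n : nat) (M : 'M[R[i]]_n) (t : R) :
  is_mxderive t (fun s => expmx (s%:C *: M)) (expmx (t%:C *: M) *m M).
Proof.
rewrite -[expmx _]mul1mx; apply: is_mxderive_expmx_factor => k.
by rewrite mul1mx exprSr mulmxE.
Qed.

Lemma expmx0 (R : realType) (n : nat) (M : 'M[R[i]]_n) : expmx (0%:C *: M) = 1%:M.
Proof.
rewrite /expmx; apply: cvg_lim; first exact: norm_hausdorff.
(* The empty partial sum is 0; the partial sums equal the identity only from index 1 on, hence the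
   shift. *)
rewrite -cvg_shiftS; apply: cvg_near_cst; apply: nearW => N.
rewrite /series /= big_nat_recl// expr0 fact0 invr1 scale1r big1 ?addr0// => k _.
by rewrite exprZmx exprS mul0r scale0r scaler0.
Qed.

(** At 0 only right continuity is asked for, because a solution has just a one-sided derivative
    there; the mean value theorem on [[0, t]] accepts this. *)
Lemma is_derive_cst_on (R : realType) (f : R -> R) (t : R) :
  0 <= t -> (forall s : R, 0 < s -> is_derive s (1 : R) f 0) ->
  f s @[s --> 0^'+] --> f 0 -> f t = f 0.
Proof.
rewrite le_eqVlt => /predU1P[<-//|t0] fd f0.
have cf s : 0 < s -> {for s, continuous f}.
  move=> s0; apply: differentiable_continuous; apply/derivable1_diffP.
  by have [] := fd s s0.
have [||c _] := @MVT _ f (fun=> 0) 0 t t0.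
- by move=> s; rewrite in_itv /= => /andP[s0 _]; exact: fd.
- apply/continuous_within_itvP => //; split => //.
    by move=> s; rewrite in_itv /= => /andP[s0 _]; exact: cf.
  by apply: cvg_at_left_filter; exact: cf.
by rewrite mul0r => /eqP; rewrite subr_eq0 => /eqP.
Qed.

Lemma is_mxderive_cst_on (R : realType) (m n : nat) (f : R -> 'M[R[i]]_(m, n))
    (t : R) :
  0 <= t -> (forall s : R, 0 < s -> is_mxderive s f 0) ->
  f s @[s --> 0^'+] --> f 0 -> f t = f 0.
Proof.
move=> t0 fd /cvg_mxP f0; apply/matrixP => i j.
have /cvg_complexP[f1 f2] := f0 i j.
apply: complex_ext.
  apply: (@is_derive_cst_on _ (fun s => Re (f s i j))) => // s s0.
  by have [] := fd s s0 i j; rewrite mxE.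
apply: (@is_derive_cst_on _ (fun s => Im (f s i j))) => // s s0.
by have [] := fd s s0 i j; rewrite mxE.
Qed.

Lemma is_mxderive_continuous (R : realType) (m n : nat) (f : R -> 'M[R[i]]_(m, n))
    (t : R) (v : 'M[R[i]]_(m, n)) :
  is_mxderive t f v -> f s @[s --> t] --> f t.
Proof.
move=> fd; apply/cvg_mxP => i j; apply/cvg_complexP.
have [[f1 _] [f2 _]] := fd i j.
by split; apply: differentiable_continuous; apply/derivable1_diffP.
Qed.

Lemma is_mxderive_expmxN (R : realType) (n : nat) (M : 'M[R[i]]_n) (t : R) :
  is_mxderive t (fun s => expmx (s%:C *: (- M))) (- (expmx (t%:C *: (- M)) *m M)).
Proof. by rewrite -mulmxN; exact: is_mxderive_expmxr. Qed.

(** The product has zero derivative: with [M] on the right of [e^(-sM)] and on the left of [e^(sM)],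
    the two terms of the product rule cancel. *)
Lemma expmxNK (R : realType) (n : nat) (M : 'M[R[i]]_n) (t : R) :
  0 <= t -> expmx (t%:C *: (- M)) *m expmx (t%:C *: M) = 1%:M.
Proof.
move=> t0; pose f s := expmx (s%:C *: (- M)) *m expmx (s%:C *: M).
have fd s : is_mxderive s f 0.
  rewrite (_ : 0 = - (expmx (s%:C *: (- M)) *m M) *m expmx (s%:C *: M) +
     expmx (s%:C *: (- M)) *m (M *m expmx (s%:C *: M))).
    by apply: is_mxderiveM; [exact: is_mxderive_expmxN|exact: is_mxderive_expmx].
  by rewrite mulNmx mulmxA addNr.
have <- : f 0 = 1%:M by rewrite /f !expmx0 mul1mx.
apply: (is_mxderive_cst_on t0) => // s; apply: cvg_at_right_filter.
exact: is_mxderive_continuous.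
Qed.

(** Integrating factor: [e^(-sM) y(s)] has zero derivative at positive times and is right continuous
    at 0. *)
Lemma linear_ode_unique (R : realType) (n : nat) (M : 'M[R[i]]_n)
    (y : R -> 'cV[R[i]]_n) (t : R) :
  0 <= t -> (forall s : R, 0 < s -> is_mxderive s y (M *m y s)) ->
  y s @[s --> 0^'+] --> y 0 -> y t = expmx (t%:C *: M) *m y 0.
Proof.
move=> t0 yd y0; pose f s := expmx (s%:C *: (- M)) *m y s.
have ft : f t = y 0.
  have <- : f 0 = y 0 by rewrite /f expmx0 mul1mx.
  apply: (is_mxderive_cst_on t0) => [s s0|].
    rewrite (_ : 0 = - (expmx (s%:C *: (- M)) *m M) *m y s +
       expmx (s%:C *: (- M)) *m (M *m y s)).
      by apply: is_mxderiveM; [exact: is_mxderive_expmxN|exact: yd].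
    by rewrite mulNmx mulmxA addNr.
  apply/cvg_mxP => i j; rewrite /f.
  under eq_fun do rewrite mxE.
  rewrite mxE; apply: cvg_big => [|k _]; first exact: add_continuous.
  apply: cvgM; last by move/cvg_mxP : y0; exact.
  apply: (cvg_mxP _ _ _).1; apply: cvg_at_right_filter.
  exact: is_mxderive_continuous (is_mxderive_expmxN _ _).
by rewrite -ft /f mulmxA (mulmx1C (expmxNK M t0)) mul1mx.
Qed.

(** * Transient growth *)

(** This is [e^(-zs)], in terms of the real exponential, cosine and sine. *)
Definition cexpN (R : realType) (z : R[i]) (s : R) : R[i] :=
  Complex (expR (- (Re z * s)) * cos (Im z * s))
    (- (expR (- (Re z * s)) * sin (Im z * s))).

Lemma is_cderive_cexpN (R : realType) (z : R[i]) (s : R) :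
  is_cderive s (cexpN z) (- z * cexpN z s).
Proof.
split; rewrite /cexpN /=; apply: is_derive_eq.
  by rewrite ReM ReN ImN /GRing.scale /=; ring.
by rewrite ImM ReN ImN /GRing.scale /=; ring.
Qed.

Lemma Re_norm_cexpN (R : realType) (z : R[i]) (s : R) :
  Re `|cexpN z s| = expR (- (Re z * s)).
Proof.
rewrite normc_def /= -[RHS]ger0_norm ?expR_ge0// -[RHS]sqrtr_sqr; congr Num.sqrt.
rewrite sqrrN !exprMn -mulrDr cos2Dsin2 mulr1//.
Qed.

Lemma cexpN0 (R : realType) (z : R[i]) : cexpN z 0 = 1.
Proof.
by rewrite /cexpN !mulr0 oppr0 expR0 cos0 sin0 mulr1 mulr0 oppr0.
Qed.

Lemma is_derive_rdot (R : realType) (n : nat) (p : 'cV[R[i]]_n)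
    (w : R -> 'cV[R[i]]_n) (w' : 'cV[R[i]]_n) (s : R) :
  is_mxderive s w w' -> is_derive s (1 : R) (fun r => rdot p (w r)) (rdot p w').
Proof.
move=> /(is_mxderiveMl (p ^t*)) /(_ ord0 ord0)[+ _]; rewrite -rdotE.
by under eq_fun do rewrite -rdotE.
Qed.

(* The mean value theorem is applied to the component of [w] along the
   increment [w tau - w 0]. *)
Lemma mean_value_exp (R : realType) (n : nat) (w w' : R -> 'cV[R[i]]_n)
    (a C tau : R) :
  0 < a -> 0 < tau -> (forall s, is_mxderive s w (w' s)) ->
  (forall s, 0 <= s <= tau -> enorm (w' s) <= C * expR (- (a * s))) ->
  enorm (w tau - w 0) <= C * (1 - expR (- (a * tau))) / a.
Proof.
move=> a0 tau0 wd w'C; set p := w tau - w 0.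
have an0 : a != 0 by rewrite gt_eqF.
(* The second summand has derivative [- |p| C e^(-as)], which by Cauchy-Schwarz outweighs that of
   [rdot p (w s)]; so [k tau <= k 0], which amounts to integrating the bound. *)
pose k s := rdot p (w s) + enorm p * C / a * expR (- (a * s)).
pose k' s := rdot p (w' s) - enorm p * C * expR (- (a * s)).
have kd s : is_derive s (1 : R) k (k' s).
  have H1 := is_derive_rdot p (wd s).
  have H2 : is_derive s (1 : R) (fun s => enorm p * C / a * expR (- (a * s)))
      (- (enorm p * C * expR (- (a * s)))).
    by apply: is_derive_eq; rewrite /GRing.scale /=; field.
  exact: is_deriveD.
have [|c ctau kk] := @MVT _ k k' 0 tau tau0.
  apply: continuous_subspaceT => s; apply: differentiable_continuous.
  by apply/derivable1_diffP; have [] := kd s.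
move: ctau; rewrite in_itv /= => /andP[c0 ctau].
have k'c : k' c <= 0.
  rewrite /k' subr_le0 (le_trans (rdot_le _ _))// -mulrA ler_wpM2l ?enorm_ge0//.
  by rewrite w'C// !ltW.
have kle : k tau - k 0 <= 0 by rewrite kk subr0 mulr_le0_ge0// ltW.
have [->|p0] := eqVneq p 0.
  rewrite enorm0 divr_ge0 ?(ltW a0)// mulr_ge0//; last first.
    by rewrite subr_ge0 expR_le1 oppr_le0 mulr_ge0// ltW.
  have := le_trans (enorm_ge0 _) (w'C 0 _).
  by rewrite mulr0 oppr0 expR0 mulr1; apply; rewrite lexx ltW.
have pp : 0 < enorm p by rewrite enorm_gt0.
(* After multiplication by [|p|], the left side [|p|^2] is the increment of [rdot p (w s)] over
   [[0, tau]]. *)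
rewrite -(ler_pM2l pp) -expr2 enorm_sqr {2}/p rdotDr rdotNr.
move: kle; rewrite /k mulr0 oppr0 expR0 mulr1; set e := expR _.
have -> : enorm p * (C * (1 - e) / a) = enorm p * C / a - enorm p * C / a * e.
  by field.
lra.
Qed.

Lemma growth_of_pseudoeigenvector (R : realType) (n : nat) (B : 'M[R[i]]_n)
    (z : R[i]) (u : 'cV[R[i]]_n) (eps tau M : R) :
  0 < eps -> 0 < Re z -> 0 < tau -> u != 0 ->
  enorm (B *m u - z *: u) <= eps * enorm u ->
  (forall t, 0 <= t <= tau -> opnorm (expmx (t%:C *: B)) <= M) ->
  growth_bound eps (Re z) tau <= M.
Proof.
move=> eps0 a0 tau0 u0 uv XM; set a := Re z in a0 *; set v := _ - _ in uv.
have M0 : 0 <= M by apply: le_trans (XM 0 _); rewrite ?opnorm_ge0// lexx ltW.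
have up : 0 < enorm u by rewrite enorm_gt0.
pose X s := expmx (s%:C *: B).
pose w s := cexpN z s *: (X s *m u); pose w' s := cexpN z s *: (X s *m v).
have wd s : is_mxderive s w (w' s).
  (* The form [e^(sB) B] of the derivative puts [B] next to [u], so that the residual [v] factors
     out. *)
  have := is_mxderiveZ (is_cderive_cexpN z s)
    (is_mxderiveMr u (is_mxderive_expmxr B s)).
  congr is_mxderive; rewrite /w' /v mulmxBr scalerBr -mulmxA addrC; congr (_ + _).
  by rewrite -scalemxAr scalerA mulNr scaleNr mulrC.
have w'C s : 0 <= s <= tau -> enorm (w' s) <= M * enorm v * expR (- (a * s)).
  move=> st; rewrite enormZ Re_norm_cexpN mulrC ler_wpM2r ?expR_ge0//.
  by rewrite (le_trans (enorm_mulmx_le _ _))// ler_wpM2r ?enorm_ge0// XM.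
have := mean_value_exp a0 tau0 wd w'C; set q := expR _ => wle.
have w0 : w 0 = u by rewrite /w cexpN0 scale1r /X expmx0 mul1mx.
have wtau : enorm (w tau) <= q * (M * enorm u).
  rewrite enormZ Re_norm_cexpN ler_wpM2l ?expR_ge0//.
  rewrite (le_trans (enorm_mulmx_le _ _))// ler_wpM2r ?enorm_ge0// XM//.
  by rewrite lexx ltW.
have uw : enorm u <= enorm (w tau) + enorm (w tau - w 0).
  rewrite -[enorm (_ - _)]enormN opprB (le_trans _ (enormD _ _))//.
  by rewrite addrC subrK w0.
have q0 : 0 < q by exact: expR_gt0.
have q1 : q < 1 by rewrite expR_lt1 oppr_lt0 mulr_gt0.
have vle : M * enorm v * (1 - q) / a <= M * (eps * enorm u) * (1 - q) / a.
  by rewrite ler_pM2r ?invr_gt0// ler_wpM2r ?subr_ge0 ?(ltW q1)// ler_wpM2l.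
(* This is [uw], with its two terms bounded through [wtau], [wle] and [vle], divided by
   [enorm u]. *)
have key : 1 <= M * (q + eps * (1 - q) / a).
  rewrite -(ler_pM2r up) mul1r.
  have -> : M * (q + eps * (1 - q) / a) * enorm u =
    q * (M * enorm u) + M * (eps * enorm u) * (1 - q) / a by ring.
  lra.
have eP : expR (tau * a) = q^-1 by rewrite /q expRN invrK mulrC.
have d0 : 0 < 1 + eps * (q^-1 - 1) / a.
  rewrite ltr_pwDl// divr_ge0 ?(ltW a0)// mulr_ge0 ?(ltW eps0)//.
  by rewrite subr_ge0 -[leLHS]invr1 lef_pV2 ?posrE// ltW.
rewrite /growth_bound eP div1r ler_pdivrMr//.
rewrite -(ler_pM2l q0) mulfV ?gt_eqF//.
have -> : q * (M * (1 + eps * (q^-1 - 1) / a)) = M * (q + eps * (1 - q) / a).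
  by field; rewrite !gt_eqF.
by [].
Qed.

(** If [X = z - B] is invertible, take [u = X^-1 v] with [v] in the unit ball attaining the norm of
    [X^-1]: then [|X u| = |v| <= 1 < eps |u|]. If [X] is singular, a kernel vector has residual
    0. *)
Lemma pseudospectrum_pseudoeigenvector (R : realType) (m : nat) (G : 'M[R[i]]_m)
    (mu : R[i]) (eps : R) (z : R[i]) :
  0 < eps -> pseudospectrum G mu eps z ->
  exists2 u : 'cV[R[i]]_m, u != 0 &
    enorm (pencil_generator G mu *m u - z *: u) <= eps * enorm u.
Proof.
move=> eps0; rewrite /pseudospectrum /= /invnorm.
set B := pencil_generator G mu; set X := _ - B.
have XE u : B *m u - z *: u = - (X *m u).
  by rewrite /X mulmxBl mul_scalar_mx opprB.
case: ifPn => [Xu|Xu _].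
  rewrite lte_fin div1r => epsX; have [v v1 vX] := opnorm_attained (invmx X).
  have uE : eps^-1 < enorm (invmx X *m v) by rewrite vX.
  exists (invmx X *m v).
    by rewrite -enorm_gt0 (lt_trans _ uE)// invr_gt0.
  rewrite XE enormN mulKVmx// (le_trans v1)// ltW//.
  by rewrite -ltr_pdivrMl ?mulr1.
(* [det0P] yields a row vector killed from the left, hence the transposes. *)
have /det0P[v v0 vX] : \det X^T == 0.
  by rewrite det_tr; move: Xu; rewrite unitmxE unitfE negbK.
exists v^T; first by rewrite -(inj_eq trmx_inj) trmxK trmx0.
rewrite XE enormN -(trmxK X) -trmx_mul vX trmx0 enorm0.
by rewrite mulr_ge0 ?enorm_ge0// ltW.
Qed.

Lemma continuous_growth_bound (R : realType) (eps tau a : R) :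
  0 < eps -> 0 < tau -> 0 < a ->
  growth_bound eps x tau @[x --> a] --> growth_bound eps a tau.
Proof.
move=> eps0 tau0 a0.
have ce : expR (tau * x) @[x --> a] --> expR (tau * a).
  by apply: continuous_comp; [exact: mulrl_continuous|exact: continuous_expR].
have d0 : 1 + eps * (expR (tau * a) - 1) / a != 0.
  rewrite gt_eqF// ltr_pwDl// divr_ge0 ?(ltW a0)// mulr_ge0 ?(ltW eps0)//.
  by rewrite subr_ge0 -expR0 ler_expR mulr_ge0// ltW.
rewrite /growth_bound; apply: cvgM => //; apply: cvgM; first exact: cvg_cst.
apply: cvgV => //; apply: cvgD; first exact: cvg_cst.
apply: cvgM; last by apply: cvgV; [rewrite gt_eqF|exact: cvg_id].
by apply: cvgM; [exact: cvg_cst|apply: cvgB => //; exact: cvg_cst].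
Qed.

Lemma growth_bound_le (R : realType) (m : nat) (G : 'M[R[i]]_m) (mu : R[i])
    (eps tau M : R) :
  0 < eps -> 0 < tau -> 0 < pseudospectral_abscissa G mu eps ->
  (forall t, 0 <= t <= tau ->
     opnorm (expmx (t%:C *: pencil_generator G mu)) <= M) ->
  growth_bound eps (pseudospectral_abscissa G mu eps) tau <= M.
Proof.
set al := pseudospectral_abscissa G mu eps => eps0 tau0 al0 XM.
have hs : has_sup [set Re z | z in pseudospectrum G mu eps].
  apply: contrapT => /sup_out h; move: al0.
  by rewrite /al /pseudospectral_abscissa h ltxx.
rewrite leNgt; apply/negP => Mg.
have := continuous_growth_bound eps0 tau0 al0.
move=> /cvgr_gt /(_ _ Mg) /nbhs_ballP[e /= e0 He].
(* The bound by [e] keeps [Re z] in the ball where the growth bound exceeds [M]; the bound by [al]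
   keeps [Re z] positive. *)
pose dl := Num.min e al.
have dl0 : 0 < dl by rewrite lt_min e0.
have [_ [z zP <-] zl] := sup_adherent dl0 hs.
have zu : Re z <= al by apply: sup_upper_bound => //; exists z.
have {}zl : al - dl < Re z by exact: zl.
have z0 : 0 < Re z.
  have dla : dl <= al by rewrite ge_min lexx orbT.
  by move: zl; clearbody al dl; lra.
have [u u0 uz] := pseudospectrum_pseudoeigenvector eps0 zP.
have := growth_of_pseudoeigenvector eps0 z0 tau0 u0 uz XM.
rewrite leNgt => /negP; apply; apply: He; rewrite /ball /=.
rewrite ger0_norm ?subr_ge0//.
have dle : dl <= e by rewrite ge_min lexx.
by move: zl; clearbody al dl; lra.
Qed.

Lemma cvg_Re_norm_sub (R : realType) (T : Type) (F : set_system T)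
    (f : T -> R[i]) (l : R[i]) : Filter F ->
  f x @[x --> F] --> l -> Re `|l - f x| @[x --> F] --> (0 : R).
Proof.
move=> FF /cvgrPdist_lt fl; apply/cvgrPdist_lt => e e0.
have e0' : 0 < e%:C by rewrite ltcR.
apply: filterS (fl _ e0') => x.
by rewrite sub0r normrN (ger0_norm (Re_norm_ge0 _)) ltcE => /andP[].
Qed.

Lemma opnorm_expmx_max (R : realType) (n : nat) (B : 'M[R[i]]_n) (tau : R) :
  0 < tau -> exists2 tm : R, 0 <= tm <= tau &
    forall t, 0 <= t <= tau ->
      opnorm (expmx (t%:C *: B)) <= opnorm (expmx (tm%:C *: B)).
Proof.
move=> tau0; pose f t := opnorm (expmx (t%:C *: B)).
have cf : continuous f.
  move=> t; apply/cvgrPdist_le => e e0.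
  have : mxsumnorm (expmx (t%:C *: B) - expmx (s%:C *: B)) @[s --> t] --> (0 : R).
    rewrite -[0](_ : \sum_(i < n) \sum_(j < n) (0 : R) = 0); last first.
      by rewrite big1// => i _; rewrite big1.
    apply: cvg_big => [|i _]; first exact: add_continuous.
    apply: cvg_big => [|j _]; first exact: add_continuous.
    have /cvg_mxP/(_ i j) c := is_mxderive_continuous (is_mxderive_expmx B t).
    under eq_fun do rewrite !mxE.
    exact: cvg_Re_norm_sub.
  move=> /cvgr_le /(_ e e0); apply: filterS => s; apply: le_trans.
  exact: opnorm_dist.
have [|tm tmI H] := @EVT_max R f 0 tau (ltW tau0); first exact: continuous_subspaceT.
by exists tm => [|t tI]; [move: tmI; rewrite in_itv|apply: H; rewrite in_itv].
Qed.

(** * Solutions of the differential-algebraic equation *)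

(** [is_derive] takes its limit over increments [h] and [has_derivative_at] over points [s]; the
    substitution [s = t + h] matches punctured balls. *)
Lemma is_derive_cvgP (R : realType) (f : R -> R) (t l : R) :
  is_derive t (1 : R) f l <->
  (s - t)^-1 * (f s - f t) @[s --> t^'] --> l.
Proof.
have shiftP : (h^-1 *: ((f \o shift t) (h *: 1) - f t) @[h --> 0^'] --> l) <->
    ((s - t)^-1 * (f s - f t) @[s --> t^'] --> l).
  split=> /cvgrPdist_lt H; apply/cvgrPdist_lt => e e0;
    have /nbhs_ballP[r /= r0 Hr] := H e e0; apply/nbhs_ballP; exists r => // s /=.
    rewrite /ball /= => sr st; have := Hr (s - t).
    rewrite /ball /= sub0r opprB subr_eq0 => /(_ sr st).
    by rewrite /GRing.scale /= mulr1 subrK.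
  rewrite /ball /= sub0r normrN => sr s0; have := Hr (s + t).
  rewrite /ball /= opprD addrCA subrr addr0 normrN => /(_ sr).
  rewrite -subr_eq0 addrK => /(_ s0).
  by rewrite /GRing.scale /= mulr1.
rewrite -shiftP; split=> [[df <-]|H]; first exact: df.
by split; [apply/cvg_ex; exists l|apply: cvg_lim].
Qed.

(** [f s] is [f 0] plus [s] times the quotient, and the latter product tends to [0 * l]. *)
Lemma right_continuous_of_quotient (R : realType) (f : R -> R) (l : R) :
  (s - 0)^-1 * (f s - f 0) @[s --> 0^'+] --> l -> f s @[s --> 0^'+] --> f 0.
Proof.
move=> fl.
have id0 : s @[s --> (0 : R)^'+] --> (0 : R) by apply: cvg_at_right_filter; exact: cvg_id.
have H : f 0 + s * ((s - 0)^-1 * (f s - f 0)) @[s --> 0^'+] --> f 0 + 0 * l.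
  by apply: cvgD; [exact: cvg_cst|exact: cvgM].
rewrite mul0r addr0 in H; apply: cvg_trans H.
apply: near_eq_cvg; near=> s => /=; rewrite subr0 mulVKf; first by rewrite addrC subrK.
by rewrite gt_eqF//; near: s; exact: nbhs_right_gt.
Unshelve. all: by end_near. Qed.

Local Notation halfline_dnbhs t := (within `[0, +oo[ t^').

Lemma has_derivative_atP (R : realType) (n : nat) (x : R -> 'cV[R[i]]_n) (t : R)
    (v : 'cV[R[i]]_n) :
  has_derivative_at x t v <-> forall i,
    ((s - t)^-1 * (Re (x s i ord0) - Re (x t i ord0)) @[s --> halfline_dnbhs t]
       --> Re (v i ord0)) /\
    ((s - t)^-1 * (Im (x s i ord0) - Im (x t i ord0)) @[s --> halfline_dnbhs t]
       --> Im (v i ord0)).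
Proof.
have eqs s i j : (((s - t)^-1)%:C *: (x s - x t)) i j =
    ((s - t)^-1)%:C * (x s i ord0 - x t i ord0) by rewrite !mxE (ord1 j).
split=> [/cvg_mxP H i|H].
  have /cvg_complexP := H i ord0; case=> H1 H2; split.
    by move: H1; under eq_fun do rewrite eqs Re_realM ReD ReN.
  by move: H2; under eq_fun do rewrite eqs Im_realM ImD ImN.
apply/cvg_mxP => i j; rewrite (ord1 j); apply/cvg_complexP; have [H1 H2] := H i.
split.
  by under eq_fun do rewrite eqs Re_realM ReD ReN.
by under eq_fun do rewrite eqs Im_realM ImD ImN.
Qed.

Lemma has_derivative_at_of_is_mxderive (R : realType) (n : nat)
    (x : R -> 'cV[R[i]]_n) (t : R) (v : 'cV[R[i]]_n) :
  is_mxderive t x v -> has_derivative_at x t v.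
Proof.
move=> xd; apply/has_derivative_atP => i.
have [/is_derive_cvgP H1 /is_derive_cvgP H2] := xd i ord0.
by split; apply: cvg_within_filter.
Qed.

Lemma is_mxderive_of_has_derivative_at (R : realType) (n : nat)
    (x : R -> 'cV[R[i]]_n) (t : R) (v : 'cV[R[i]]_n) :
  0 < t -> has_derivative_at x t v -> is_mxderive t x v.
Proof.
move=> t0 /has_derivative_atP H i j; rewrite (ord1 j); have [H1 H2] := H i.
(* A positive [t] is interior to the half-line, so restricting to it changes no limit at [t]. *)
have le : t^' `=>` halfline_dnbhs t.
  move=> P; rewrite /within /= => HP.
  have tP : \forall s \near t^', 0 < s.
    by apply: nbhs_dnbhs; exact: lt_nbhsr.
  apply: filterS2 tP HP => s s0; apply.
  by rewrite /= in_itv /= andbT ltW.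
by split; apply/is_derive_cvgP; [move: H1|move: H2]; apply: cvg_trans;
  exact: cvg_app.
Qed.

Lemma right_continuous_of_has_derivative_at (R : realType) (n : nat)
    (x : R -> 'cV[R[i]]_n) (v : 'cV[R[i]]_n) :
  has_derivative_at x 0 v -> x s @[s --> 0^'+] --> x 0.
Proof.
move=> /has_derivative_atP H; apply/cvg_mxP => i j; rewrite (ord1 j).
have [H1 H2] := H i.
have le : (0 : R)^'+ `=>` halfline_dnbhs (0 : R).
  move=> P HP; apply: (@filterS _ (nbhs (0 : R)) _ _ _ _ HP) => s Hs s0.
  apply: Hs; first by rewrite gt_eqF.
  by rewrite /= in_itv /= andbT ltW.
apply/cvg_complexP; split; apply: right_continuous_of_quotient.
  by apply: cvg_trans H1; exact: cvg_app.
by apply: cvg_trans H2; exact: cvg_app.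
Qed.

(** The power of [N] is lowered step by step. If [N^(k+1) w] vanishes for all positive times, so
    does its derivative [N^(k+1) w'], and applying [N^k] to [w = N (w' - mu w)] gives
    [N^k w = 0]. *)
Lemma nilpotent_dae_zero (R : realType) (d : nat) (N : 'M[R[i]]_d) (mu : R[i])
    (k : nat) (w w' : R -> 'cV[R[i]]_d) :
  (forall s : R, 0 < s -> is_mxderive s w (w' s)) ->
  (forall s : R, 0 < s -> N *m (w' s - mu *: w s) = w s) ->
  (forall s : R, 0 < s -> N ^+ k *m w s = 0) ->
  forall s : R, 0 < s -> w s = 0.
Proof.
move=> wd Nw; elim: k => [|k IH] Nk s s0; first by rewrite -(Nk s s0) expr0 mul1mx.
apply: IH => // {s0}s s0.
have Nk' : N ^+ k.+1 *m w' s = 0.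
  apply: (is_mxderive_unique (is_mxderiveMl (N ^+ k.+1) (wd s s0))).
  apply: (@is_mxderive_ext _ _ _ s (fun=> 0)); last exact: is_mxderive_cst.
  by apply: filterS (lt_nbhsr s0) => r /Nk ->.
have NS : N ^+ k *m N = N ^+ k.+1 by rewrite exprSr mulmxE.
rewrite -Nw// mulmxA NS mulmxBr Nk' -scalemxAr Nk//.
by rewrite scaler0 subrr.
Qed.

(** With the number of columns a variable, [p] can be replaced by [n]; then [U] is square and a
    right inverse is also a left inverse. *)
Lemma unitarymx_adjK (R : realType) (n p : nat) (U : 'M[R[i]]_(n, p)) :
  p = n -> U \is unitarymx -> U ^t* *m U = 1%:M.
Proof. by move=> pn; subst p; move=> /unitarymxP; exact: mulmx1C. Qed.

(** Subtracting [mu E x] from both sides of [E v = A x] gives [E (v - mu x) = (A - mu E) x], and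
    [A - mu E] is invertible. *)
Lemma dae_shift_inv (R : realType) (n : nat) (A E : 'M[R[i]]_n) (mu : R[i])
    (v x : 'cV[R[i]]_n) :
  A - mu *: E \in unitmx ->
  E *m v = A *m x <-> shift_inv A E mu *m (v - mu *: x) = x.
Proof.
move=> Su.
have AE : A = A - mu *: E + mu *: E by rewrite subrK.
rewrite /shift_inv -mulmxA mulmxBr -scalemxAr.
have -> : E *m v = A *m x <-> E *m v - mu *: (E *m x) = (A - mu *: E) *m x.
  rewrite mulmxBl -scalemxAl; split=> [->//|/eqP].
  by rewrite subr_eq subrK => /eqP.
split=> [->|]; first by rewrite mulKmx.
by move=> {2}<-; rewrite mulKVmx.
Qed.

Lemma eigenvalue0_unitmx (F : fieldType) (n : nat) (G : 'M[F]_n) :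
  ~~ eigenvalue G 0 -> G \in unitmx.
Proof.
rewrite /eigenvalue negbK /eigenspace raddf0 subr0 kermx_eq0.
by rewrite row_free_unit.
Qed.

Lemma schur_adjoint (R : realType) (n p d : nat) (Q : 'M[R[i]]_(n, p))
    (Qt : 'M[R[i]]_(n, d)) :
  (p + d)%N = n -> row_mx Q Qt \is unitarymx ->
  [/\ Q ^t* *m Q = 1%:M, Q ^t* *m Qt = 0, Qt ^t* *m Q = 0 &
      Qt ^t* *m Qt = 1%:M] /\ Q *m Q ^t* + Qt *m Qt ^t* = 1%:M.
Proof.
move=> pd U; have := unitarymx_adjK pd U; move: U => /unitarymxP.
rewrite tr_row_mx map_col_mx mul_row_col => ->.
rewrite mul_col_row [X in _ = X -> _]scalar_mx_block.
by move=> /eq_block_mx[-> -> -> ->].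
Qed.

(** Multiplying by the two adjoints splits the equation; conversely, [Q Q^* + Qt Qt^* = 1]
    reassembles [x]. *)
Lemma schur_dae_blocks (R : realType) (n p d : nat) (Q : 'M[R[i]]_(n, p))
    (Qt : 'M[R[i]]_(n, d)) (G : 'M[R[i]]_p) (D : 'M[R[i]]_(p, d)) (N : 'M[R[i]]_d)
    (v x : 'cV[R[i]]_n) :
  (p + d)%N = n -> row_mx Q Qt \is unitarymx ->
  row_mx Q Qt *m block_mx G D 0 N *m (row_mx Q Qt) ^t* *m v = x <->
  G *m (Q ^t* *m v) + D *m (Qt ^t* *m v) = Q ^t* *m x /\
  N *m (Qt ^t* *m v) = Qt ^t* *m x.
Proof.
move=> pd U; have [[QQ QQt QtQ QtQt] QQ1] := schur_adjoint pd U.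
rewrite tr_row_mx map_col_mx -!mulmxA [X in _ *m (_ *m X)]mul_col_mx.
rewrite mul_block_col mul_row_col.
rewrite mul0mx add0r; split=> [<-|[-> ->]].
  rewrite !mulmxDr !(mulmxA _ Q) !(mulmxA _ Qt) QQ QQt QtQ QtQt.
  by rewrite !mul1mx !mul0mx addr0 !add0r.
by rewrite !mulmxA -mulmxDl QQ1 mul1mx.
Qed.

Lemma is_mxderive_reduced_solution (R : realType) (n p : nat)
    (Q : 'M[R[i]]_(n, p)) (B : 'M[R[i]]_p) (y : 'cV[R[i]]_p) (t : R) :
  is_mxderive t (fun s => Q *m (expmx (s%:C *: B) *m y))
    (Q *m (B *m (expmx (t%:C *: B) *m y))).
Proof.
apply: is_mxderiveMl; rewrite mulmxA.
by apply: is_mxderiveMr; exact: is_mxderive_expmx.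
Qed.

Lemma mulmx_pencil_generator (R : realType) (m : nat) (G : 'M[R[i]]_m) (mu : R[i])
    (y y' : 'cV[R[i]]_m) :
  G \in unitmx ->
  G *m (y' - mu *: y) = y <-> y' = pencil_generator G mu *m y.
Proof.
move=> Gu; rewrite /pencil_generator mulmxDl mul_scalar_mx; split=> [Gy|->].
  by rewrite -{1}Gy mulKmx// subrK.
by rewrite addrK mulKVmx.
Qed.

(* In the coordinates [y = Q^* x], [w = Qt^* x], the pencil decouples: [w]
   solves [N (w' - mu w) = w] and vanishes because [N] is nilpotent. *)
Lemma unique_dae_solution_schur (R : realType) (n d : nat) (A E : 'M[R[i]]_n)
    (mu : R[i]) (Q : 'M[R[i]]_(n, n - d)) (Qt : 'M[R[i]]_(n, d))
    (G : 'M[R[i]]_(n - d)) (D : 'M[R[i]]_(n - d, d)) (N : 'M[R[i]]_d)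
    (y0 : 'cV[R[i]]_(n - d)) :
  A - mu *: E \in unitmx -> (d <= n)%N ->
  schur_factorization A E mu Q Qt G D N ->
  unique_dae_solution A E (Q *m y0)
    (fun t => Q *m (expmx (t%:C *: pencil_generator G mu) *m y0)).
Proof.
move=> Su dn [_ U SE _ [k Nk] /eigenvalue0_unitmx Gu].
have pd := subnK dn.
have [[QQ QQt QtQ QtQt] QQ1] := schur_adjoint pd U.
set B := pencil_generator G mu.
have daeE (v x : 'cV[R[i]]_n) : E *m v = A *m x <->
    G *m (Q ^t* *m v - mu *: (Q ^t* *m x)) +
      D *m (Qt ^t* *m v - mu *: (Qt ^t* *m x)) = Q ^t* *m x /\
    N *m (Qt ^t* *m v - mu *: (Qt ^t* *m x)) = Qt ^t* *m x.
  apply: (iff_trans (dae_shift_inv v x Su)); rewrite SE.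
  apply: (iff_trans (schur_dae_blocks G D N (v - mu *: x) x pd U)).
  by rewrite !mulmxBr -!scalemxAr.
split.
  split=> [|t t0]; first by rewrite expmx0 mul1mx.
  have xd := is_mxderive_reduced_solution Q B y0 t.
  exists (Q *m (B *m (expmx (t%:C *: B) *m y0))).
    exact: has_derivative_at_of_is_mxderive.
  apply/daeE; rewrite !(mulmxA _ Q) QQ QtQ !mul1mx !mul0mx scaler0 subrr !mulmx0.
  by rewrite addr0; split => //; apply/(mulmx_pencil_generator _ _ _ Gu).
move=> x [x0 xdae] t t0.
(* Choice gathers the pointwise derivatives into one function, with the default value 0 at negative
   times. *)
have /choice[x' x'P] : forall s, exists v, 0 <= s ->
    has_derivative_at x s v /\ E *m v = A *m x s.
  move=> s; have [s0|s0] := leP 0 s; last by exists 0.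
  by have [v xv Ev] := xdae s s0; exists v.
have xd s : 0 < s -> is_mxderive s x (x' s).
  by move=> s0; have [/is_mxderive_of_has_derivative_at -/(_ s0)] := x'P s (ltW s0).
have xr : x s @[s --> 0^'+] --> x 0.
  by have [/right_continuous_of_has_derivative_at] := x'P 0 (lexx 0).
pose w s := Qt ^t* *m x s; pose y s := Q ^t* *m x s.
have wd s : 0 < s -> is_mxderive s w (Qt ^t* *m x' s).
  by move=> s0; apply: is_mxderiveMl; exact: xd.
have w0 s : 0 < s -> w s = 0.
  apply: (nilpotent_dae_zero (N := N) (mu := mu) (k := k) wd) => r r0.
    by have [_ /daeE[]] := x'P r (ltW r0).
  by rewrite Nk mul0mx.
(* Once [w] and its derivative both vanish, the coupling term with [D] drops out and [y' = B y]
   remains. *)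
have w'0 s : 0 < s -> Qt ^t* *m x' s = 0.
  move=> s0; apply: (is_mxderive_unique (wd s s0)).
  apply: (@is_mxderive_ext _ _ _ s (fun=> 0)); last exact: is_mxderive_cst.
  by apply: filterS (lt_nbhsr s0) => r /w0 ->.
have yd s : 0 < s -> is_mxderive s y (B *m y s).
  move=> s0; have [_ /daeE[]] := x'P s (ltW s0).
  rewrite -/(w s) w0// w'0// scaler0 subrr mulmx0 addr0 => + _.
  move=> /(mulmx_pencil_generator _ _ _ Gu) <-.
  by apply: is_mxderiveMl; exact: xd.
have yr : y s @[s --> 0^'+] --> y 0.
  have := @cvg_mulmx _ _ _ _ _ _ _ (Q ^t*) 1%:M x _ _ xr; rewrite mulmx1.
  by under eq_fun do rewrite mulmx1; apply.
(* At time 0 this comes from the initial condition, as [Qt^* Q = 0]. *)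
have wt : w t = 0.
  move: t0; rewrite le_eqVlt => /predU1P[<-|/w0//].
  rewrite /w x0 mulmxA QtQ mul0mx//.
have yt := linear_ode_unique t0 yd yr.
have y00 : y 0 = y0 by rewrite /y x0 mulmxA QQ mul1mx.
rewrite -[LHS]mul1mx -QQ1 mulmxDl -!mulmxA -/(w t) -/(y t) wt mulmx0 addr0.
by rewrite yt y00.
Qed.

Theorem theorem4p6 (R : realType) (n d : nat) (A E : 'M[R[i]]_n) (mu : R[i])
    (Q : 'M[R[i]]_(n, n - d)) (Qt : 'M[R[i]]_(n, d))
    (G : 'M[R[i]]_(n - d)) (D : 'M[R[i]]_(n - d, d)) (N : 'M[R[i]]_d)
    (eps : R)
    (hreg : regular_pencil A E)
    (hstable : forall lambda : R[i],
       finite_eigenvalue A E lambda -> complex.Re lambda < 0)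
    (hmu : A - mu *: E \in unitmx)
    (hd : (d < n)%N)
    (hschur : schur_factorization A E mu Q Qt G D N)
    (heps : 0 < eps)
    (halpha : 0 < pseudospectral_abscissa G mu eps)
    (tau : R) (htau : 0 < tau) :
  (exists tm : R,
     [/\ 0 <= tm <= tau,
         forall t : R, 0 <= t <= tau ->
           opnorm (expmx (t%:C *: pencil_generator G mu))
             <= opnorm (expmx (tm%:C *: pencil_generator G mu))
       & growth_bound eps (pseudospectral_abscissa G mu eps) tau
           <= opnorm (expmx (tm%:C *: pencil_generator G mu))]) /\
  (exists (x0 : 'cV[R[i]]_n) (t : R) (x : R -> 'cV[R[i]]_n),
     [/\ x0 != 0,
         exists y : 'cV[R[i]]_(n - d), x0 = Q *m y,
         0 <= t <= tau,
         unique_dae_solution A E x0 x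
       & growth_bound eps (pseudospectral_abscissa G mu eps) tau
           <= enorm (x t) / enorm x0]).
Proof.
set al := pseudospectral_abscissa G mu eps in halpha *.
set B := pencil_generator G mu.
have [tm tmI tmmax] := opnorm_expmx_max B htau.
have growth : growth_bound eps al tau <= opnorm (expmx (tm%:C *: B)).
  exact: growth_bound_le.
split; first by exists tm.
have [y y1 yM] := opnorm_attained (expmx (tm%:C *: B)).
(* Positivity of the bound forces the maximiser [y], and with it the initial condition, to be
   nonzero. *)
have gpos : 0 < growth_bound eps al tau.
  rewrite /growth_bound mulr_gt0 ?expR_gt0// divr_gt0// ltr_pwDl//.
  rewrite divr_ge0 ?(ltW halpha)// mulr_ge0 ?(ltW heps)//.
  by rewrite subr_ge0 -expR0 ler_expR mulr_ge0// ltW.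
have y0 : 0 < enorm y.
  rewrite enorm_gt0; apply/eqP => y0; move: (lt_le_trans gpos growth).
  by rewrite -yM y0 mulmx0 enorm0 ltxx.
have U := schur_unitary hschur.
have [[QQ _ _ _] _] := schur_adjoint (subnK (ltnW hd)) U.
exists (Q *m y), tm, (fun t => Q *m (expmx (t%:C *: B) *m y)); split => //.
- by rewrite -enorm_gt0 enorm_isometry.
- by exists y.
- exact: unique_dae_solution_schur hmu (ltnW hd) hschur.
(* Dividing by [enorm y], which is at most 1, can only increase the ratio. *)
rewrite !(enorm_isometry _ QQ) yM (le_trans growth)// ler_pdivlMr//.
by rewrite -[leRHS]mulr1 ler_wpM2l// opnorm_ge0.
Qed.
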